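(* Let $G$ be a locally compact second countable group and let $\mathcal{H}$ be a uniformly recurrent subgroup (URS) of $G$. Then the universal minimal flow $M(G, \mathcal{H})$ of $G$ relative to $\mathcal{H}$ is metrizable if and only if $\mathcal{H}$ contains a cocompact subgroup of $G$ (that is, some $H \in \mathcal{H}$ with $G/H$ compact).
   Context: Locally compact groups and compact spaces are assumed Hausdorff. $\operatorname{Sub}(G)$ is the set of closed subgroups of $G$ with the Chabauty topology, which has as subbasis of open sets the sets $\{H : H \cap C = \varnothing\}$ with $C \subseteq G$ compact, and $\{H : H \cap V \neq \varnothing\}$ with $V \subseteq G$ open; $G$ acts on it continuously by conjugation. A URS of $G$ is a nonempty closed, conjugation-invariant, minimal subset of $\operatorname{Sub}(G)$. A compact $G$-space is a compact space with a continuous action of $G$; it is minimal if it is nonempty and every orbit is dense. For a minimal compact $G$-space $X$, the closure in $\operatorname{Sub}(G)$ of the set of point stabilizers contains a unique URS, denoted $\mathcal{S}_G(X)$. For URSs write $\mathcal{H} \preceq \mathcal{K}$ if every $H \in \mathcal{H}$ is contained in some $K \in \mathcal{K}$. A minimal compact $G$-space $X$ is subordinate to $\mathcal{H}$ if $\mathcal{H} \preceq \mathcal{S}_G(X)$. The universal minimal flow of $G$ relative to $\mathcal{H}$, denoted $M(G,\mathcal{H})$, is the minimal compact $G$-space, unique up to $G$-equivariant homeomorphism, which is subordinate to $\mathcal{H}$ and admits a continuous surjective $G$-equivariant map onto every minimal compact $G$-space subordinate to $\mathcal{H}$ (it exists and is unique for every URS $\mathcal{H}$). It can be realized as any minimal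 closed $G$-invariant subset of $S(G/H)$, for any $H \in \mathcal{H}$, where $S(G/H)$ is the Gelfand spectrum of the $C^*$-algebra of bounded functions on $G/H$ that are uniformly continuous for the uniformity with entourages $\{(g_1H,g_2H) : \exists v \in V,\ vg_1H = g_2H\}$, $V$ a symmetric neighborhood of $1_G$. *)

(* Defs.v *)
From HB Require Import structures.
From mathcomp Require Import all_boot all_order all_algebra.
From mathcomp Require Import all_classical all_reals all_analysis.

Set Implicit Arguments.
Unset Strict Implicit.
Unset Printing Implicit Defensive.

Local Open Scope classical_set_scope.
Local Open Scope group_scope.

(* Multiplicative counterpart of the library's topologicalZmodType; as there,
   neither separation nor local compactness is built in. *)
HB.mixin Record isTopologicalGroup G & Topological G & Group G := {
  mulg_continuous : continuous (fun p : G * G => p.1 * p.2) ;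
  invg_continuous : continuous (fun x : G => x^-1)
}.

#[short(type="topologicalGroupType")]
HB.structure Definition TopologicalGroup :=
  {G of Topological G & Group G & isTopologicalGroup G}.

Record closedSubgroup (G : topologicalGroupType) := ClosedSubgroup {
  csg_set :> set G ;
  csg_one : csg_set 1 ;
  csg_mul : forall x y, csg_set x -> csg_set y -> csg_set (x * y) ;
  csg_inv : forall x, csg_set x -> csg_set x^-1 ;
  csg_closed : closed csg_set
}.

HB.instance Definition _ (G : topologicalGroupType) :=
  gen_eqMixin (closedSubgroup G).
HB.instance Definition _ (G : topologicalGroupType) :=
  gen_choiceMixin (closedSubgroup G).

Definition chabauty_subbase (G : topologicalGroupType) :
    set (set (closedSubgroup G)) :=
  [set [set H : closedSubgroup G | H `&` C = set0] | C in @compact G] `|`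
  [set [set H : closedSubgroup G | H `&` V !=set0] | V in @open G].

HB.instance Definition _ (G : topologicalGroupType) :=
  isSubBaseTopological.Build (closedSubgroup G) (@chabauty_subbase G) id.

Section Conjugation.
Variables (G : topologicalGroupType) (g : G) (H : closedSubgroup G).

Definition conjs : set G := [set g * h * g^-1 | h in H].

Lemma conjsE : conjs = (fun x => g^-1 * x * g) @^-1` H.
Proof.
apply/seteqP; split => [_ [h Hh <-]|x Hx] /=.
  by rewrite !mulgA mulVg mul1g mulgVK.
by exists (g^-1 * x * g) => //; rewrite !mulgA mulgV mul1g mulgK.
Qed.

Lemma conjs_one : conjs 1.
Proof. by exists 1; [exact: csg_one|rewrite mulg1 mulgV]. Qed.

Lemma conjs_mul x y : conjs x -> conjs y -> conjs (x * y).
Proof.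
move=> [h Hh <-] [k Hk <-]; exists (h * k); first exact: csg_mul.
by rewrite !mulgA mulgVK.
Qed.

Lemma conjs_inv x : conjs x -> conjs x^-1.
Proof.
move=> [h Hh <-]; exists h^-1; first exact: csg_inv.
by rewrite !invgM invgK mulgA.
Qed.

Lemma conjs_closed : closed conjs.
Proof.
rewrite conjsE; apply: preimage_closed; last exact: csg_closed.
move=> x _.
have cM (u v : G -> G) : continuous u -> continuous v ->
    continuous (fun y => u y * v y).
  move=> cu cv y.
  apply: (@continuous_comp _ _ _ (fun z => (u z, v z))
            (fun p : G * G => p.1 * p.2)); last exact: mulg_continuous.
  by apply: cvg_pair; [exact: cu|exact: cv].
by apply: (cM); [apply: (cM)|] => y; [exact: cvg_cst|exact: cvg_id|exact: cvg_cst].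
Qed.

Definition conjsg : closedSubgroup G :=
  ClosedSubgroup conjs_one conjs_mul conjs_inv conjs_closed.

End Conjugation.

Definition conj_invariant (G : topologicalGroupType)
    (A : set (closedSubgroup G)) : Prop :=
  forall (g : G) H, A H -> A (conjsg g H).

Definition is_URS (G : topologicalGroupType)
    (A : set (closedSubgroup G)) : Prop :=
  [/\ A !=set0, closed A, conj_invariant A &
    forall B : set (closedSubgroup G),
      B `<=` A -> B !=set0 -> closed B -> conj_invariant B -> B = A].

Definition URS_le (G : topologicalGroupType)
    (A B : set (closedSubgroup G)) : Prop :=
  forall H, A H -> exists2 K, B K & (H : set G) `<=` (K : set G).

Record compactGSpace (G : topologicalGroupType) := CompactGSpace {
  cgs_space :> topologicalType ;
  cgs_act : G -> cgs_space -> cgs_space ;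
  cgs_act1 : forall x, cgs_act 1 x = x ;
  cgs_actM : forall g h x, cgs_act (g * h) x = cgs_act g (cgs_act h x) ;
  cgs_continuous : continuous (fun p : G * cgs_space => cgs_act p.1 p.2) ;
  cgs_compact : compact [set: cgs_space] ;
  cgs_hausdorff : hausdorff_space cgs_space
}.

Definition minimal_flow (G : topologicalGroupType) (X : compactGSpace G) :
    Prop :=
  [set: X] !=set0 /\ forall x : X, dense (range (fun g : G => cgs_act g x)).

Section Stabilizer.
Variables (G : topologicalGroupType) (X : compactGSpace G) (x : X).

Definition stab_set : set G := [set g | cgs_act g x = x].

Lemma stab_one : stab_set 1.
Proof. exact: cgs_act1. Qed.

Lemma stab_mul g h : stab_set g -> stab_set h -> stab_set (g * h).
Proof. by rewrite /stab_set /= cgs_actM => gx ->. Qed.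

Lemma stab_inv g : stab_set g -> stab_set g^-1.
Proof. by rewrite /stab_set /= => gx; rewrite -{1}gx -cgs_actM mulVg cgs_act1. Qed.

Lemma stab_closed : closed stab_set.
Proof.
have -> : stab_set = (fun g : G => cgs_act g x) @^-1` [set x] by [].
apply: preimage_closed.
  move=> g _.
  apply: (@continuous_comp _ _ _ (fun z => (z, x))
            (fun p : G * X => cgs_act p.1 p.2)); last exact: cgs_continuous.
  by apply: cvg_pair; [exact: cvg_id|exact: cvg_cst].
exact: accessible_closed_set1 (hausdorff_accessible (@cgs_hausdorff _ X)) _.
Qed.

Definition stabilizer : closedSubgroup G :=
  ClosedSubgroup stab_one stab_mul stab_inv stab_closed.

End Stabilizer.

(* For G locally compact and X minimal, exactly one set satisfies this
   description, so that [get] returns it; the value is irrelevant otherwise. *)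
Definition stabilizer_URS (G : topologicalGroupType) (X : compactGSpace G) :
    set (closedSubgroup G) :=
  get [set S | is_URS S /\ S `<=` closure (range (@stabilizer G X))].

Definition subordinate (G : topologicalGroupType)
    (A : set (closedSubgroup G)) (X : compactGSpace G) : Prop :=
  URS_le A (stabilizer_URS X).

(* The defining property of M(G, A), which determines it up to equivariant
   homeomorphism. *)
Definition is_universal_minimal_flow (G : topologicalGroupType)
    (A : set (closedSubgroup G)) (M : compactGSpace G) : Prop :=
  [/\ minimal_flow M, subordinate A M &
    forall X : compactGSpace G, minimal_flow X -> subordinate A X ->
      exists f : M -> X, [/\ continuous f, range f = [set: X] &
        forall (g : G) (m : M), f (cgs_act g m) = cgs_act g (f m)]].

Section CosetSpace.
Variables (G : topologicalGroupType) (H : closedSubgroup G).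

(* x H = y H *)
Definition same_coset : rel G := fun x y => `[< csg_set H (x^-1 * y) >].

Lemma same_coset_refl : reflexive same_coset.
Proof. by move=> x; apply/asboolP; rewrite mulVg; exact: csg_one. Qed.

Lemma same_coset_sym : symmetric same_coset.
Proof.
by move=> x y; apply/asboolP/asboolP => /csg_inv; rewrite invgM invgK.
Qed.

Lemma same_coset_trans : transitive same_coset.
Proof.
move=> y x z /asboolP xy /asboolP yz; apply/asboolP.
by have := csg_mul xy yz; rewrite mulgA mulgK.
Qed.

Definition same_coset_equiv :=
  EquivRel same_coset same_coset_refl same_coset_sym same_coset_trans.

Definition coset_space : topologicalType :=
  quotient_topology {eq_quot same_coset_equiv}%qT.

Definition cocompact : Prop := compact [set: coset_space].

End CosetSpace.

Definition metrizable (R : realType) (T : topologicalType) : Prop :=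
  exists d : T -> T -> R,
    [/\ forall x y, d x y = 0%R <-> x = y,
        forall x y, d x y = d y x,
        forall x y z, (d x z <= d x y + d y z)%R &
        forall x, nbhs x =
          filter_from [set e : R | (0 < e)%R] (fun e => [set y | (d x y < e)%R])].

(* Main.v *)
Require Import Defs.
From HB Require Import structures.
From mathcomp Require Import finmap all_boot all_order all_algebra.
From mathcomp Require Import all_classical all_reals all_analysis.
From mathcomp Require Import lra.

(* If [H] in [calH] is cocompact then, [M] being subordinate to [calH], [H] fixes
   a point [m] of [M]; compactness of [G/H] makes the orbit map [g |-> g m] open
   and onto, so [M] is second countable, hence metrizable.

   Conversely, embed [G/H], for [H] in [calH], into a compact flow of families of
   closed subsets of [G] that plays the part of [S(G/H)], and let [X] be a minimal
   closed invariant subset of the closure of the image.  A Veech-type argument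
   shows that every stabilizer of [X] belongs to [calH]: a point [p] of [X] is a
   limit of cosets [y H] with [y H y^-1] converging to some [L] in [calH], which
   fixes [p], and Katetov's three-set lemma on separated nets of [G/H] shows that
   nothing outside [L] does.  Hence [X] is subordinate to [calH] and is a factor
   of [M].
   When [M] is metrizable, every point in the closure of a subset of [X] is the
   limit of a sequence in it, whereas in [X] convergent sequences approach their
   limit along its orbit; so orbits are open, [X] is a single orbit [K p] with [K]
   compact, and the stabilizer of [p] is a cocompact element of [calH]. *)

Set Implicit Arguments.
Unset Strict Implicit.
Unset Printing Implicit Defensive.
Import Order.TTheory GRing.Theory Num.Theory numFieldNormedType.Exports.
Local Open Scope classical_set_scope.
Local Open Scope group_scope.

(** * Subbases, limits along ultrafilters, minimal sets *)

Lemma subbase_open (T : topologicalType) (I : choiceType) (D : set I) (b : I -> set T) :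
  @open T = [set \bigcup_(A in D') A | D' in subset^~ (finI_from D b)] ->
  forall i, D i -> open (b i).
Proof.
move=> openT i Di; rewrite openT; exists [set b i]; last by rewrite bigcup_set1.
move=> _ ->; exists [fset i]%fset; first by move=> j /fset1P ->; rewrite inE.
by rewrite set_fset1 bigcap_set1.
Qed.

Lemma subbase_cvg (T : topologicalType) (I : choiceType) (D : set I) (b : I -> set T) :
  @open T = [set \bigcup_(A in D') A | D' in subset^~ (finI_from D b)] ->
  forall (F : set_system T) (p : T), Filter F ->
  (forall i, D i -> b i p -> F (b i)) -> F --> p.
Proof.
move=> openT F p FF Fb A; rewrite nbhsE => -[B [oB Bp] BA].
apply: filterS BA _; move: oB Bp; rewrite openT => -[D' D'D <-] [C D'C Cp].
apply: (filterS (P := C)); first exact: bigcup_sup.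
have [J JD JC] := D'D _ D'C; rewrite -JC in Cp *.
apply: filter_bigI => i iJ.
by apply: Fb; [exact/set_mem/JD|exact: Cp].
Qed.

Lemma ultra_setC (I : Type) (F : set_system I) (A : set I) :
  UltraFilter F -> ~ F A -> F (~` A).
Proof. by move=> FU nFA; have [] := in_ultra_setVsetC A FU. Qed.

Lemma ultra_compact_cvg (T : topologicalType) (I : Type) (F : set_system I)
    (z : I -> T) :
  compact [set: T] -> UltraFilter F -> exists p : T, z @ F --> p.
Proof.
move=> cT FU; have [p [_ clp]] := cT (fmap z F) _ (@filterT _ F _).
exists p => A pA; apply: contrapT => nFA.
have nA : F (~` (z @^-1` A)) by exact: ultra_setC.
by have [t [nAt At]] := clp (~` A) A nA pA.
Qed.

Section LimitSet.
Variables (T : topologicalType) (I : Type) (F : set_system I) (c : I -> set T).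

(** The lower Kuratowski limit of the [c i] along [F]. Along an ultrafilter it is a limit for the
    hit-or-miss topologies, which gives compactness of both the Chabauty and the Fell space. *)
Definition limit_set : set T :=
  [set x | forall V, open V -> V x -> F [set i | c i `&` V !=set0]].

Lemma limit_set_hits V :
  open V -> limit_set `&` V !=set0 -> F [set i | c i `&` V !=set0].
Proof. by move=> oV [x [Lx Vx]]; exact: Lx. Qed.

Lemma closed_limit_set : closed limit_set.
Proof.
move=> x clx V oV Vx; apply: (limit_set_hits oV).
by apply: clx; exact: open_nbhs_nbhs.
Qed.

(** Each point of [C] has a neighbourhood that [F]-almost all [c i] miss, because [F] is ultra;
    compactness of [C], in its near-covering form, makes this uniform. *)
Lemma limit_set_misses C : UltraFilter F -> compact C ->
  limit_set `&` C = set0 -> F [set i | c i `&` C = set0].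
Proof.
move=> FU /compact_near_coveringP cC LC.
have : \forall i \near F, C `<=` (fun x => ~ c i x).
  apply: cC => x Cx.
  have [V [oV Vx nFV]] :
      exists V, [/\ open V, V x & ~ F [set i | c i `&` V !=set0]].
    apply: contrapT => nV; suff : set0 x by [].
    rewrite -LC; split=> // V oV Vx; apply: contrapT => nFV; apply: nV.
    by exists V.
  exists (V, ~` [set i | c i `&` V !=set0]) => /=.
    by split; [exact: open_nbhs_nbhs|exact: ultra_setC].
  by move=> [y i] [/= Vy ncV] ciy; apply: ncV; exists y.
apply: filterS => i Ci; apply/seteqP; split=> // y [ciy Cy].
exact: Ci Cy ciy.
Qed.

End LimitSet.

(** Zorn's lemma on complements: a maximal open [A] with invariant complement and not covering [C]
    gives the minimal set as [C] minus [A]. *)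
Lemma minimal_closed_invariant (T : topologicalType) (J : Type)
    (a : J -> T -> T) (C : set T) :
    compact [set: T] -> closed C -> C !=set0 ->
    (forall g x, C x -> C (a g x)) ->
  exists B, [/\ B `<=` C, B !=set0, closed B, forall g x, B x -> B (a g x) &
    forall B', B' `<=` B -> B' !=set0 -> closed B' ->
      (forall g x, B' x -> B' (a g x)) -> B' = B].
Proof.
move=> cT clC C0 Cinv.
pose P := [set A : set T | [/\ open A, forall g x, ~ A x -> ~ A (a g x) &
  ~ C `<=` A]].
have [F FP Ftot|A [[oA Ainv nCA] Amax]] := @Zorn_bigcup _ P.
  split.
  - by apply: bigcup_open => A /FP[].
  - move=> g x nx [A FA Ax]; have [_ Ainv _] := FP _ FA.
    by apply: (Ainv g x) => // A'; apply: nx; exists A.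
  - move=> CF.
    (* The tails of the chain form a filter; were the union to cover [C], compactness would make a
       single member cover it. *)
    pose FF := filter_from F (fun A => [set B | F B /\ A `<=` B]).
    have [x0 /CF[A0 FA0 _]] := C0.
    have FFP : ProperFilter FF.
      apply: filter_from_proper; last by move=> A FA; exists A; split.
      apply: filter_from_filter; first by exists A0.
      move=> A B FA FB; have [AB|BA] := Ftot _ _ FA FB.
        exists B => // D [FD BD]; split; split=> //.
        exact: subset_trans AB BD.
      exists A => // D [FD AD]; split; split=> //.
      exact: subset_trans BA AD.
    have /compact_near_coveringP cC : compact C by exact: subclosed_compact clC cT _.
    have : \forall B \near FF, C `<=` (fun x => B x).
      apply: cC => x /CF[A FA Ax].
      exists (A, [set B | F B /\ A `<=` B]) => /=.
        split; last by exists A.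
        by apply: open_nbhs_nbhs; split => //; have [] := FP _ FA.
      by move=> [y B] [/= Ay [_ AB]]; exact: AB.
    case=> B FB /(_ B) CB; have [_ _] := FP _ FB; apply.
    by apply: CB; split.
exists (~` A `&` C); split.
- by move=> x [].
- apply: contrapT => nAC; apply: nCA => x Cx; apply: contrapT => nAx.
  by apply: nAC; exists x.
- by apply: closedI => //; exact: open_closedC.
- by move=> g x [nAx Cx]; split; [exact: Ainv|exact: Cinv].
- move=> B BAC [x Bx] clB Binv; apply/seteqP; split=> // y [nAy Cy].
  apply: contrapT => nBy; apply: (Amax (~` B)).
    split; last by move=> BA; exact: nAy (BA _ nBy).
    by move=> z Az /BAC[].
  split; first exact: closed_openC.
    by move=> g z /contrapT Bz; apply; exact: Binv.
  by move=> CB; apply: (CB x); [have [] := BAC _ Bx|].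
Qed.

(** * The Chabauty space *)

Lemma cvgMg (G : topologicalGroupType) (I : Type) (F : set_system I)
    (FF : Filter F) (u v : I -> G) (a b : G) :
  u @ F --> a -> v @ F --> b -> (fun i => u i * v i) @ F --> a * b.
Proof.
move=> ua vb; apply: (@cvg_comp _ _ _ (fun i => (u i, v i))
  (fun p : G * G => p.1 * p.2) _ _ _ _ (@mulg_continuous G (a, b))).
exact: cvg_pair.
Qed.

Lemma cvgVg (G : topologicalGroupType) (I : Type) (F : set_system I)
    (FF : Filter F) (u : I -> G) (a : G) :
  u @ F --> a -> (fun i => (u i)^-1) @ F --> a^-1.
Proof. by move=> ua; exact: cvg_comp ua (@invg_continuous G a). Qed.

Lemma cvg_act (G : topologicalGroupType) (X : compactGSpace G) (I : Type)
    (F : set_system I) (FF : Filter F) (u : I -> G) (z : I -> X) (g : G) (x : X) :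
  u @ F --> g -> z @ F --> x ->
  (fun i => cgs_act (u i) (z i)) @ F --> cgs_act g x.
Proof.
move=> ug zx; apply: (@cvg_comp _ _ _ (fun i => (u i, z i))
  (fun p : G * X => cgs_act p.1 p.2) _ _ _ _ (@cgs_continuous _ X (g, x))).
exact: cvg_pair.
Qed.

Section Subgroups.
Variable G : topologicalGroupType.

Lemma closedSubgroup_eq (H K : closedSubgroup G) :
  (H : set G) = (K : set G) -> H = K.
Proof.
case: H K => [H H1 HM HV Hc] [K K1 KM KV Kc] /= HK; move: HK H1 HM HV Hc => ->.
by move=> *; congr ClosedSubgroup; exact: Prop_irrelevance.
Qed.

Lemma open_chabauty_hits (V : set G) :
  open V -> open [set H : closedSubgroup G | H `&` V !=set0].
Proof.
by move=> oV; apply: (@subbase_open (closedSubgroup G) _ (@chabauty_subbase G) id) => //;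
  right; exists V.
Qed.

Lemma open_chabauty_misses (C : set G) :
  compact C -> open [set H : closedSubgroup G | H `&` C = set0].
Proof.
by move=> cC; apply: (@subbase_open (closedSubgroup G) _ (@chabauty_subbase G) id) => //;
  left; exists C.
Qed.

Lemma chabauty_cvg (F : set_system (closedSubgroup G)) (FF : Filter F)
    (L : closedSubgroup G) :
  (forall V, open V -> L `&` V !=set0 ->
    F [set H : closedSubgroup G | H `&` V !=set0]) ->
  (forall C, compact C -> L `&` C = set0 ->
    F [set H : closedSubgroup G | H `&` C = set0]) ->
  F --> L.
Proof.
move=> hits misses.
apply: (@subbase_cvg (closedSubgroup G) _ (@chabauty_subbase G) id) => //.
by move=> _ [[C cC <-]|[V oV <-]]; [exact: misses|exact: hits].
Qed.

(** An ultrafilter converges to the limit set of its subgroups, again a subgroup because the group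
    operations are continuous. *)
Lemma compact_closedSubgroup : compact [set: closedSubgroup G].
Proof.
rewrite compact_ultra => F FU _; pose c (H : closedSubgroup G) : set G := H.
have L1 : limit_set F c 1.
  move=> V oV V1; apply: (@filterS _ F _ setT) => [H _|]; last exact: filterT.
  by exists 1; split=> //; exact: csg_one.
have LM x y : limit_set F c x -> limit_set F c y -> limit_set F c (x * y).
  move=> Lx Ly V oV Vxy.
  have /= : nbhs (x * y) V by exact: open_nbhs_nbhs.
  move=> /(@mulg_continuous G (x, y))[[A B] /= [nA nB] ABV].
  move: nA nB; rewrite !nbhsE => -[A' [oA A'x] A'A] [B' [oB B'y] B'B].
  apply: filterS2 (Lx _ oA A'x) (Ly _ oB B'y) => H [a [Ha Aa]] [b [Hb Bb]].
  exists (a * b); split; first exact: csg_mul.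
  by apply: (ABV (a, b)); split; [exact: A'A|exact: B'B].
have LV x : limit_set F c x -> limit_set F c x^-1.
  move=> Lx V oV Vx; have : nbhs x^-1 V by exact: open_nbhs_nbhs.
  move=> /(@invg_continuous G x); rewrite /= nbhsE => -[A [oA Ax] AV].
  apply: filterS (Lx _ oA Ax) => H [a [Ha Aa]].
  by exists a^-1; split; [exact: csg_inv|exact: AV].
exists (ClosedSubgroup L1 LM LV (@closed_limit_set _ _ F c)); split=> //.
apply: chabauty_cvg => [V oV LV0|C cC LC0].
  exact: limit_set_hits LV0.
exact: limit_set_misses LC0.
Qed.

Lemma conjsg_continuous (g : G) : continuous (conjsg g).
Proof.
move=> H; apply: chabauty_cvg => [|V oV|C cC].
  by apply: fmap_filter; exact: nbhs_filter.
  pose W := (fun x : G => g * x * g^-1) @^-1` V.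
  have oW : open W.
    apply: open_comp oV => x _; apply: cvgMg; last exact: cvg_cst.
    by apply: cvgMg; [exact: cvg_cst|exact: cvg_id].
  move=> [_ [[h Hh <-] Vh]].
  have : nbhs H [set H : closedSubgroup G | H `&` W !=set0].
    by apply: open_nbhs_nbhs; split; [exact: open_chabauty_hits|exists h].
  apply: filterS => K [k [Kk Wk]].
  by exists (g * k * g^-1); split=> //; exists k.
move=> HC.
pose D := (fun x : G => g^-1 * x * g) @` C.
have cD : compact D.
  apply: continuous_compact cC.
  apply: continuous_subspaceT => x; apply: cvgMg; last exact: cvg_cst.
  by apply: cvgMg; [exact: cvg_cst|exact: cvg_id].
have HD : (H : set G) `&` D = set0.
  apply/seteqP; split=> // y [Hy [x Cx xE]].
  suff : set0 x by [].
  by rewrite -HC; split=> //; rewrite /= conjsE /= xE.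
have : nbhs H [set H : closedSubgroup G | H `&` D = set0].
  by apply: open_nbhs_nbhs; split; [exact: open_chabauty_misses|].
apply: filterS => K KD; apply/seteqP; split=> // x [].
rewrite /= conjsE /= => Kx Cx.
suff : set0 (g^-1 * x * g) by [].
by rewrite -KD; split=> //; exists x.
Qed.

End Subgroups.

(** * Flows and their stabilizers *)

Lemma compact_nbhs (T : topologicalType) (x : T) (U : set T) :
    hausdorff_space T -> locally_compact [set: T] -> nbhs x U ->
  exists C, [/\ nbhs x C, compact C & C `<=` U].
Proof.
move=> hT lcT Ux; have := lcT x I; rewrite withinET => -[V Vx].
move=> [/= cV clV].
have [D Dx DU] := compact_regular hT cV Vx Ux.
exists (closure D `&` V); split.
- by apply: filterI => //; apply: filterS Dx; exact: subset_closure.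
- by rewrite setIC; apply: compact_closedI => //; exact: closed_closure.
- by move=> y [/DU].
Qed.

Section Flows.
Variable G : topologicalGroupType.

Lemma act_inj (X : compactGSpace G) (g : G) : injective (@cgs_act G X g).
Proof.
move=> x y /(congr1 (cgs_act g^-1)).
by rewrite -!cgs_actM mulVg !cgs_act1.
Qed.

Lemma stabilizer_act (X : compactGSpace G) (g : G) (x : X) :
  stabilizer (cgs_act g x) = conjsg g (stabilizer x).
Proof.
apply: closedSubgroup_eq; rewrite /= conjsE; apply/seteqP.
split=> h; rewrite /stab_set /=.
  by move=> hx; rewrite /stab_set /= !cgs_actM hx -cgs_actM mulVg cgs_act1.
by move=> /(congr1 (cgs_act g)); rewrite -!cgs_actM !mulgA mulgV mul1g.
Qed.

(** An [x] in [K] is approached by elements [v] of [S i] fixing [z i]; if [x] moved [m], then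
    [v z i = z i] would lie both near [x m] and near [m]. The sets [S i] may be smaller than the
    stabilizers, so that conjugates of [H] can be used. *)
Lemma stab_limit (X : compactGSpace G) (I : Type) (F : set_system I)
    (PF : ProperFilter F) (z : I -> X) (m : X) (S : I -> set G) (K : set G) :
    z @ F --> m -> (forall i, S i `<=` stab_set (z i)) ->
    (forall V, open V -> K `&` V !=set0 -> F [set i | S i `&` V !=set0]) ->
  K `<=` stab_set m.
Proof.
move=> zm Sz KS x Kx; rewrite /stab_set /=; apply/eqP; apply: contrapT => xm.
have := @cgs_hausdorff _ X; rewrite open_hausdorff => /(_ _ _ (introN idP xm)).
move=> [[A B] /=]; rewrite !inE => -[Axm Bm] [oA oB AB].
have : nbhs (cgs_act x m) A by exact: open_nbhs_nbhs.
move=> /(@cgs_continuous _ X (x, m))[[V O] /= [nV nO] VOA].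
have {}nO : nbhs m (O `&` B) by apply: filterI => //; exact: open_nbhs_nbhs.
move: nV; rewrite nbhsE => -[W [oW Wx] WV].
have FW : F [set i | S i `&` W !=set0] by apply: KS oW _; exists x.
have FO : F (z @^-1` (O `&` B)) by exact: zm nO.
have [i [[v [/Sz Sv /WV Vv]] [Oz Bz]]] := filter_ex (filterI FW FO).
have := VOA (v, z i) (conj Vv Oz); rewrite /= Sv => Az.
by suff : set0 (z i) by []; rewrite -AB.
Qed.

(** Choose points whose stabilizers tend to [K] and, by compactness, a limit [x] of them along an
    ultrafilter; then [stab_limit] applies. *)
Lemma closure_stabilizer_le (X : compactGSpace G) (K : closedSubgroup G) :
  closure (range (@stabilizer G X)) K ->
  exists x : X, (K : set G) `<=` stab_set x.
Proof.
move=> clK.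
pose F0 := filter_from (nbhs K) (fun B => @stabilizer G X @^-1` B).
have PF0 : ProperFilter F0.
  apply: filter_from_proper => [|B /clK[_ [[x _ <-] Bx]]]; last by exists x.
  apply: filter_from_filter; first by exists setT; exact: filterT.
  by move=> A B KA KB; exists (A `&` B) => //; exact: filterI.
have [F [FU F0F]] := ultraFilterLemma PF0.
have [x Fx] := @ultra_compact_cvg X X F id (@cgs_compact _ X) FU.
exists x; apply: (@stab_limit X X F _ id x (@stab_set G X)) => [//|y //|].
move=> V oV KV; apply: (F0F [set y : X | stab_set y `&` V !=set0]).
exists [set H : closedSubgroup G | H `&` V !=set0] => //.
by apply: open_nbhs_nbhs; split=> //; exact: open_chabauty_hits.
Qed.

Lemma exists_stabilizer_URS (X : compactGSpace G) : [set: X] !=set0 ->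
  exists S, is_URS S /\ S `<=` closure (range (@stabilizer G X)).
Proof.
move=> [x0 _].
have [|||B [BC B0 clB Binv Bmin]] := @minimal_closed_invariant (closedSubgroup G)
  G (@conjsg G) (closure (range (@stabilizer G X))) (@compact_closedSubgroup G).
- exact: closed_closure.
- by exists (stabilizer x0); apply: subset_closure; exists x0.
- move=> g H clH A /(@conjsg_continuous G g H) /clH[_ [[x _ <-] Ax]].
  exists (conjsg g (stabilizer x)); split=> //.
  by exists (cgs_act g x) => //; exact: stabilizer_act.
by exists B.
Qed.

Lemma stabilizer_URSP (X : compactGSpace G) : [set: X] !=set0 ->
  is_URS (stabilizer_URS X) /\
  stabilizer_URS X `<=` closure (range (@stabilizer G X)).
Proof. by move=> /exists_stabilizer_URS/getPex. Qed.

(** Any URS inside the closure of the stabilizers is then inside the closed set [A], hence equal to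
    it by minimality of [A]. *)
Lemma stabilizer_URS_eq (X : compactGSpace G) (A : set (closedSubgroup G)) :
    [set: X] !=set0 -> is_URS A -> range (@stabilizer G X) `<=` A ->
  stabilizer_URS X = A.
Proof.
move=> X0 [A0 clA Ainv Amin] XA.
have [[S0 clS Sinv _] SX] := stabilizer_URSP X0.
by apply: Amin => // H /SX /(closureS XA); exact: clA.
Qed.

Section Subflow.
Variables (X : compactGSpace G) (B : set X).
Hypotheses (closedB : closed B) (invB : forall g x, B x -> B (cgs_act g x)).

Definition subflow_act (g : G) (x : B) : B :=
  exist _ (cgs_act g (\val x)) (mem_set (invB g (set_mem (valP x)))).

Lemma subflow_act1 (x : B) : subflow_act 1 x = x.
Proof. by apply: val_inj; exact: cgs_act1. Qed.

Lemma subflow_actM (g h : G) (x : B) :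
  subflow_act (g * h) x = subflow_act g (subflow_act h x).
Proof. by apply: val_inj; exact: cgs_actM. Qed.

Lemma val_continuous : continuous (\val : B -> X).
Proof. exact: initial_continuous. Qed.

Lemma cvg_subflow (I : Type) (F : set_system I) (FF : Filter F)
    (z : I -> B) (x : B) :
  (fun i => \val (z i)) @ F --> \val x -> z @ F --> x.
Proof.
move=> zx A [_ [[W oW <-] Wx WA]].
have FW : F ((fun i => \val (z i)) @^-1` W) := zx W (open_nbhs_nbhs (conj oW Wx)).
by suff : F (z @^-1` A) by []; apply: filterS FW => i Wi; exact: WA.
Qed.

Lemma subflow_continuous :
  continuous (fun p : G * B => subflow_act p.1 p.2).
Proof.
move=> [g x].
apply: (@cvg_subflow _ (nbhs (g, x)) _ (fun p : G * B => subflow_act p.1 p.2)).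
apply: (@cvg_act _ _ _ (nbhs (g, x)) _ fst (fun p : G * B => \val p.2)).
  exact: cvg_fst.
apply: (@cvg_comp _ _ _ snd (\val : B -> X) _ _ _ _ (@val_continuous x)).
exact: cvg_snd.
Qed.

Lemma subflow_compact : compact [set: B].
Proof.
rewrite compact_ultra => F FU _.
have [x Fx] := @ultra_compact_cvg X B F \val (@cgs_compact _ X) FU.
have Bx : B x.
  apply: closedB => A nA; have FA : F ((\val : B -> X) @^-1` A) := Fx A nA.
  by have [y Ay] := filter_ex FA; exists (\val y); split=> //; exact/set_mem/valP.
exists (exist _ x (mem_set Bx)); split=> //.
exact: (@cvg_subflow B F _ id).
Qed.

Lemma subflow_hausdorff : hausdorff_space B.
Proof.
move=> x y xy; apply: val_inj; apply: (@cgs_hausdorff _ X) => U V Ux Vy.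
have [z [Uz Vz]] := xy _ _ (@val_continuous x _ Ux) (@val_continuous y _ Vy).
by exists (\val z).
Qed.

Definition subflow : compactGSpace G :=
  CompactGSpace subflow_act1 subflow_actM subflow_continuous subflow_compact
    subflow_hausdorff.

End Subflow.

End Flows.

(** * The Fell flow *)

Record closedFamily (T : topologicalType) (J : Type) := ClosedFamily {
  cf_set :> J -> set T;
  cf_closed : forall j, closed (cf_set j)
}.

HB.instance Definition _ (T : topologicalType) (J : Type) :=
  gen_eqMixin (closedFamily T J).
HB.instance Definition _ (T : topologicalType) (J : Type) :=
  gen_choiceMixin (closedFamily T J).

(* The Fell topology on the closed subsets of [J * T], with [J] discrete. *)
Definition fell_subbase (T : topologicalType) (J : Type) :
    set (set (closedFamily T J)) :=
  [set A | exists j, exists2 C, compact C &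
    A = [set p : closedFamily T J | p j `&` C = set0]] `|`
  [set A | exists j, exists2 V, open V &
    A = [set p : closedFamily T J | p j `&` V !=set0]].

HB.instance Definition _ (T : topologicalType) (J : Type) :=
  isSubBaseTopological.Build (closedFamily T J) (@fell_subbase T J) id.

Section Fell.
Variables (T : topologicalType) (J : Type).
Local Notation family := (closedFamily T J).

Lemma closedFamily_eq (p q : family) : (forall j, p j = q j) -> p = q.
Proof.
case: p q => [p pc] [q qc] /= /funext pq; rewrite -pq in qc *.
by congr ClosedFamily; exact: Prop_irrelevance.
Qed.

Lemma open_fell_hits j (V : set T) :
  open V -> open [set p : family | p j `&` V !=set0].
Proof.
move=> oV; apply: (@subbase_open family _ (@fell_subbase T J) id) => //.
by right; exists j, V.
Qed.

Lemma open_fell_misses j (C : set T) :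
  compact C -> open [set p : family | p j `&` C = set0].
Proof.
move=> cC; apply: (@subbase_open family _ (@fell_subbase T J) id) => //.
by left; exists j, C.
Qed.

Lemma fell_cvg (F : set_system family) (p : family) : Filter F ->
  (forall j V, open V -> p j `&` V !=set0 ->
    F [set q : family | q j `&` V !=set0]) ->
  (forall j C, compact C -> p j `&` C = set0 ->
    F [set q : family | q j `&` C = set0]) ->
  F --> p.
Proof.
move=> FF hits misses.
apply: (@subbase_cvg family _ (@fell_subbase T J) id) => //.
by move=> _ [[j [C cC ->]]|[j [V oV ->]]]; [exact: misses|exact: hits].
Qed.

Lemma compact_closedFamily : compact [set: family].
Proof.
rewrite compact_ultra => F FU _.
pose p := @ClosedFamily T J (fun j => limit_set F (fun q : family => q j))
  (fun j => @closed_limit_set _ _ F _).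
exists p; split=> //; apply: fell_cvg => j V oV pV.
  exact: limit_set_hits pV.
exact: limit_set_misses pV.
Qed.

(** A point of [p j] outside [q j] has a compact neighbourhood [C] missing [q j]; hitting the
    interior of [C] and missing [C] are disjoint open conditions. *)
Lemma hausdorff_closedFamily :
  hausdorff_space T -> locally_compact [set: T] -> hausdorff_space family.
Proof.
move=> hT lcT.
have sub (p q : family) : cluster (nbhs p) q -> forall j, p j `<=` q j.
  move=> pq j x px; apply: contrapT => nqx.
  have : nbhs x (~` q j).
    by apply: open_nbhs_nbhs; split=> //; exact/closed_openC/cf_closed.
  move=> /(compact_nbhs hT lcT)[C [Cx cC Cq]].
  have [||r [[y [ry /interior_subset Cy]] rC]] := pq
      [set r : family | r j `&` C° !=set0] [set r : family | r j `&` C = set0].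
  - apply: open_nbhs_nbhs; split; last by exists x.
    by apply: open_fell_hits; exact: open_interior.
  - apply: open_nbhs_nbhs; split; first exact: open_fell_misses.
    by apply/seteqP; split=> // y [qy /Cq].
  - by suff : set0 y by []; rewrite -rC.
move=> p q pq; apply: closedFamily_eq => j; apply/seteqP; split.
  exact: sub.
by apply: sub => A B qA pB; rewrite setIC; exact: pq.
Qed.

End Fell.

Section FellFlow.
Variable G : topologicalGroupType.
Hypotheses (hG : hausdorff_space G) (lcG : locally_compact [set: G]).
Local Notation family := (closedFamily G (set G)).

Lemma translate_closed (g : G) (p : family) (E : set G) :
  closed [set x | p E (x * g)].
Proof.
apply: (@preimage_closed _ _ (fun x => x * g)); last exact: cf_closed.
by move=> x _; apply: cvgMg; [exact: cvg_id|exact: cvg_cst].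
Qed.

(** The index [E] is a test set replacing a bounded function on [G/H]. With [p E] read as the set of
    [x] such that [x p] adheres to [E], the point [g p] must record the [x] with [x g] in [p E]. *)
Definition translate (g : G) (p : family) : family :=
  ClosedFamily (@translate_closed g p).

Lemma translate1 p : translate 1 p = p.
Proof.
apply: closedFamily_eq => E /=.
by apply/seteqP; split=> x /=; rewrite mulg1.
Qed.

Lemma translateM g h p : translate (g * h) p = translate g (translate h p).
Proof.
apply: closedFamily_eq => E /=.
by apply/seteqP; split=> x /=; rewrite mulgA.
Qed.

(** Hitting an open set is stable by continuity of [y * h^-1]. For missing a compact [C], each
    [x * g] with [x] in [C] gets a compact neighbourhood [D] missed by [p E], and compactness of [C]
    makes the choice uniform. *)
Lemma translate_continuous :
  continuous (fun p : G * family => translate p.1 p.2).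
Proof.
move=> [g p]; apply: fell_cvg => [E V oV|E C cC].
- move=> [x [/= px Vx]].
  pose f (z : G * G) := z.1 * z.2^-1.
  have /(_ V) : f @ (x * g, g) --> x.
    rewrite -{2}(mulgK g x); apply: cvgMg; first exact: cvg_fst.
    by apply: cvgVg; exact: cvg_snd.
  case=> [|[A B] /= [nA nB] ABV]; first exact: open_nbhs_nbhs.
  move: nA; rewrite nbhsE => -[A' [oA A'x] A'A].
  exists (B, [set q : family | q E `&` A' !=set0]) => /=.
    split=> //; apply: open_nbhs_nbhs; split; first exact: open_fell_hits.
    by exists (x * g).
  move=> [h q] [/= Bh [y [qy A'y]]].
  exists (y * h^-1); rewrite /= mulgVK; split=> //.
  by apply: (ABV (y, h)); split=> //; exact: A'A.
- move=> /= pC; have /compact_near_coveringP cvC := cC.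
  have : nbhs (g, p) [set z : G * family | C `<=` (fun x => ~ z.2 E (x * z.1))].
    have FF : Filter (nbhs ((g, p) : G * family)) by exact: nbhs_filter.
    apply: (cvC _ _ (fun (z : G * family) x => ~ z.2 E (x * z.1)) FF).
    move=> x Cx.
    have : nbhs (x * g) (~` p E).
      apply: open_nbhs_nbhs; split; first exact/closed_openC/cf_closed.
      by move=> pxg; suff : set0 x by []; rewrite -pC.
    move=> /(compact_nbhs hG lcG)[D [Dxg cD Dp]].
    move: (@mulg_continuous G (x, g) D Dxg) => [[A B] /= [nA nB] ABD].
    exists (A, B `*` [set q : family | q E `&` D = set0]) => /=.
      split=> //; exists (B, [set q : family | q E `&` D = set0]) => //=.
      split=> //; apply: open_nbhs_nbhs; split; first exact: open_fell_misses.
      by apply/seteqP; split=> // y [py /Dp].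
    move=> [y [h q]] [/= Ay [Bh qD]] qyh.
    suff : set0 (y * h) by []. 
    by rewrite -qD; split=> //; exact: (ABD (y, h)).
  apply: filterS => -[h q] Chq; apply/seteqP; split=> // x [/= qx Cx].
  exact: Chq Cx qx.
Qed.

Definition fell_flow : compactGSpace G :=
  @CompactGSpace G family translate translate1 translateM
    translate_continuous
    (@compact_closedFamily G (set G))
    (@hausdorff_closedFamily G (set G) hG lcG).

Section Hat.
Variable H : closedSubgroup G.

Lemma hat_closed (y : G) (E : set G) :
  closed (closure [set x | exists2 h, csg_set H h & E (x * y * h)]).
Proof. exact: closed_closure. Qed.

(* The Fell flow plays the part of [S(G/H)], and [hat y] that of the point [y H]. *)
Definition hat (y : G) : fell_flow := ClosedFamily (@hat_closed y).

Lemma hat_coset (y h : G) : csg_set H h -> hat (y * h) = hat y.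
Proof.
move=> Hh; apply: closedFamily_eq => E /=; congr closure.
apply/seteqP; split=> x /= [k Hk Ek].
  by exists (h * k); [exact: csg_mul|rewrite !mulgA in Ek *].
exists (h^-1 * k); first by apply: csg_mul => //; exact: csg_inv.
by rewrite !mulgA mulgK.
Qed.

Lemma hat_act (g y : G) : cgs_act g (hat y) = hat (g * y).
Proof.
apply: closedFamily_eq => E /=; apply/seteqP; split=> x /= clx A nA.
  have : nbhs (x * g) ((fun z => z * g^-1) @^-1` A).
    have f : (fun z => z * g^-1) @ (x * g) --> x * g * g^-1.
      by apply: cvgMg; [exact: cvg_id|exact: cvg_cst].
    by apply: f; rewrite mulgK.
  move=> /clx[z [[h Hh Eh] Az]]; exists (z * g^-1); split=> //.
  by exists h => //; rewrite !mulgA mulgVK.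
have : nbhs x ((fun z => z * g) @^-1` A).
  have f : (fun z => z * g) @ x --> x * g.
    by apply: cvgMg; [exact: cvg_id|exact: cvg_cst].
  exact: f.
move=> /clx[z [[h Hh Eh] Az]]; exists (z * g); split=> //.
by exists h => //; rewrite !mulgA in Eh *.
Qed.

Lemma hat_stab (y : G) : conjsg y H `<=` stab_set (hat y).
Proof.
move=> _ [h Hh <-]; suff : cgs_act (y * h * y^-1) (hat y) = hat y by [].
by rewrite hat_act mulgVK hat_coset.
Qed.

Lemma closure_hat_act (g : G) (p : fell_flow) :
  closure (range hat) p -> closure (range hat) (cgs_act g p).
Proof.
move=> clp A nA.
have f : (fun q : fell_flow => cgs_act g q) @ p --> cgs_act g p.
  apply: (@cvg_act _ _ _ (nbhs p) _ (fun=> g) id); last exact: cvg_id.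
  exact: cvg_cst.
have [_ [[y _ <-] Ay]] := clp _ (f _ nA).
by exists (cgs_act g (hat y)); split=> //; exists (g * y); rewrite ?hat_act.
Qed.

End Hat.

End FellFlow.

(** * Stabilizers in the Fell flow *)

Lemma maximal_independent (T : Type) (D : set T) (r : T -> T -> Prop) :
    (forall x, D x -> ~ r x x) ->
  exists B, [/\ B `<=` D, forall x y, B x -> B y -> ~ r x y &
    forall x, D x -> B x \/ exists2 b, B b & r x b \/ r b x].
Proof.
move=> irr.
pose P := [set B : set T | B `<=` D /\ forall x y, B x -> B y -> ~ r x y].
have [F FP Ftot|B [[BD Bind] Bmax]] := @Zorn_bigcup _ P.
  split=> [x [B FB Bx]|x y [B FB Bx] [B' FB' B'y]].
    by have [BD _] := FP _ FB; exact: BD.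
  have [BB'|B'B] := Ftot _ _ FB FB'.
    by have [_ ind] := FP _ FB'; apply: ind => //; exact: BB'.
  by have [_ ind] := FP _ FB; apply: ind => //; exact: B'B.
exists B; split=> // x Dx; apply: contrapT => /not_orP[nBx nrx].
apply: (Bmax (B `|` [set x])).
  by split=> [y By|/(_ x)]; [left|move/(_ (or_intror erefl))].
split=> [y [/BD//|->//]|y z [By|->] [Bz|->]].
- exact: Bind.
- by move=> ryx; apply: nrx; exists y => //; right.
- by move=> rxz; apply: nrx; exists z => //; left.
- exact: irr.
Qed.

(* Katetov's three-set lemma, for partial injections. *)
Lemma independent_cover (T : Type) (D : set T) (r : T -> T -> Prop) :
    (forall x, D x -> ~ r x x) ->
    (forall x y z, D x -> D y -> D z -> r x y -> r x z -> y = z) ->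
    (forall x y z, D x -> D y -> D z -> r x z -> r y z -> x = y) ->
  exists B1 B2 B3, D `<=` B1 `|` B2 `|` B3 /\
    forall B, B = B1 \/ B = B2 \/ B = B3 ->
      B `<=` D /\ forall x y, B x -> B y -> ~ r x y.
Proof.
move=> irr fun_r inj_r; have [B [BD Bind Bmax]] := maximal_independent irr.
(* Besides the maximal independent [B]: the points sent into [B] and the images of points of [B].
   They are independent because [r] is single-valued and injective, respectively. *)
exists B, [set x | D x /\ exists2 b, B b & r x b],
  [set x | D x /\ exists2 b, B b & r b x]; split.
  move=> x Dx; have [Bx|[b Bb [rxb|rbx]]] := Bmax x Dx.
  - by left; left.
  - by left; right; split=> //; exists b.
  - by right; split=> //; exists b.
move=> _ [->|[->|->]]; split=> //; try by move=> x [].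
- move=> x y [Dx [b Bb rxb]] [Dy [b' Bb' ryb']] rxy.
  have b'y := fun_r _ _ _ Dx (BD _ Bb) Dy rxb rxy.
  by apply: (Bind b b') => //; rewrite b'y.
- move=> x y [Dx [b Bb rbx]] [Dy [b' Bb' rby]] rxy.
  have xb := inj_r _ _ _ Dx (BD _ Bb') Dy rxy rby.
  by apply: (Bind b b') => //; rewrite -xb.
Qed.

Lemma compact_symmetric_nbhs (G : topologicalGroupType) (W : set G) :
    hausdorff_space G -> locally_compact [set: G] -> nbhs 1 W ->
  exists U, [/\ nbhs 1 U, compact U, U `<=` W & forall x, U x -> U x^-1].
Proof.
move=> hG lcG /(compact_nbhs hG lcG)[C [C1 cC CW]].
have cV : continuous (fun x : G => x^-1) := @invg_continuous G.
exists (C `&` (fun x => x^-1) @^-1` C); split.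
- apply: filterI => //; have : (fun x : G => x^-1) @ (1 : G) --> (1 : G)^-1 := cV 1.
  by rewrite invg1 => /(_ C C1).
- apply: compact_closedI => //; apply: preimage_closed; first by move=> x _; exact: cV.
  exact: compact_closed.
- by move=> x [/CW].
- by move=> x [Cx CVx]; split=> //=; rewrite invgK.
Qed.

(** * Separated nets in the coset space *)

Section Nets.
Variable G : topologicalGroupType.
Variable H : closedSubgroup G.

Definition thicken (N D : set G) : set G :=
  [set y | exists n d h, [/\ N n, D d, csg_set H h & y = n * d * h]].

(** A maximal separated set is automatically [U]-dense. Since [U] contains 1, it has at most one
    representative in each coset. *)
Lemma separated_net (U : set G) : U 1 -> (forall x, U x -> U x^-1) ->
  exists D, (forall y, thicken U D y) /\
    forall d d' u h, D d -> D d' -> U u -> csg_set H h -> d' = u * d * h -> d' = d.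
Proof.
move=> U1 UV.
pose r x y := x <> y /\ exists u h, [/\ U u, csg_set H h & y = u * x * h].
have [|D [_ Dind Dmax]] := @maximal_independent G setT r.
  by move=> x _ [].
exists D; split.
  move=> y; have [//|Dy|[d Dd [[_ [u [h [Uu Hh E]]]]|[_ [u [h [Uu Hh E]]]]]]] := Dmax y.
  - exists 1, y, 1; split=> //; first exact: csg_one.
    by rewrite mul1g mulg1.
  - exists u^-1, d, h^-1; split=> //; [exact: UV|exact: csg_inv|].
    by rewrite E !mulgA mulVg mul1g mulgK.
  - by exists u, d, h.
move=> d d' u h Dd Dd' Uu Hh E; apply: contrapT => dd'.
apply: (Dind d d') => //; split; first exact/nesym.
by exists u, h.
Qed.

(** The point [u] is a limit along [F] of displacements from the net to [y]. If each [u] in [U] had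
    a bad neighbourhood, compactness would leave some [y] outside [U D H]. *)
Lemma ultra_thicken (F : set_system G) (U D : set G) : UltraFilter F ->
    compact U -> (forall y, thicken U D y) ->
  exists2 u, U u & forall N, nbhs u N -> F (thicken N D).
Proof.
move=> FU /compact_near_coveringP cU UD; apply: contrapT => nu.
have : \forall y \near F, U `<=` (fun u => ~ thicken [set u] D y).
  apply: cU => u Uu.
  have [N [Nu nFN]] : exists N, nbhs u N /\ ~ F (thicken N D).
    apply: contrapT => nN; apply: nu; exists u => // N Nu.
    by apply: contrapT => nFN; apply: nN; exists N.
  exists (N, ~` thicken N D) => /=; first by split=> //; exact: ultra_setC.
  move=> [v y] [/= Nv nNy] [_ [d [h [-> Dd Hh E]]]]; apply: nNy.
  by exists v, d, h.
move=> /filter_ex[y Uy]; have [u [d [h [Uu Dd Hh E]]]] := UD y.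
by apply: (Uy u Uu); exists u, d, h.
Qed.

(** The window [Q] is a small neighbourhood of [u^-1 * g * u], the displacement that [g] induces on
    a net seen through [u]. The factor [n3] is independent of [n1] and [n2], as three unrelated
    elements of [N] occur when the window is used. *)
Lemma conjugate_window (U C : set G) (u g : G) : nbhs 1 U -> nbhs g C ->
  exists N T, [/\ nbhs u N, nbhs g T,
    (forall n1 n2 n3 t, N n1 -> N n2 -> N n3 -> T t ->
      C (n3 * (n1^-1 * t * n2) * n3^-1)) &
    exists2 Q : set G, (forall n1 n2 t, N n1 -> N n2 -> T t -> Q (n1^-1 * t * n2)) &
      forall k k', Q k -> Q k' -> U (k * k'^-1) /\ U (k^-1 * k')].
Proof.
move=> U1 Cg; set k0 := u^-1 * g * u.
have nk1 : nbhs (k0, k0) [set z : G * G | U (z.1 * z.2^-1)].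
  have : (fun z : G * G => z.1 * z.2^-1) @ (k0, k0) --> k0 * k0^-1.
    by apply: cvgMg; [exact: cvg_fst|apply: cvgVg; exact: cvg_snd].
  by rewrite mulgV => /(_ U U1).
have nk2 : nbhs (k0, k0) [set z : G * G | U (z.1^-1 * z.2)].
  have : (fun z : G * G => z.1^-1 * z.2) @ (k0, k0) --> k0^-1 * k0.
    by apply: cvgMg; [apply: cvgVg; exact: cvg_fst|exact: cvg_snd].
  by rewrite mulVg => /(_ U U1).
have [[Q1 Q2] /= [nQ1 nQ2] Q12] := filterI nk1 nk2.
(* All conditions hold near [(u, u, u, g)] in the variables [(n1, n2, n3, t)], by continuity. *)
have c0 : (fst : G * G * G * G -> G * G * G) @ (u, u, u, g) --> (u, u, u).
  exact: cvg_fst.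
have c00 : (fun z : G * G * G * G => z.1.1) @ (u, u, u, g) --> (u, u).
  by apply: cvg_comp c0 _; exact: cvg_fst.
have c1 : (fun z : G * G * G * G => z.1.1.1) @ (u, u, u, g) --> u.
  by apply: cvg_comp c00 _; exact: cvg_fst.
have c2 : (fun z : G * G * G * G => z.1.1.2) @ (u, u, u, g) --> u.
  by apply: cvg_comp c00 _; exact: cvg_snd.
have c3 : (fun z : G * G * G * G => z.1.2) @ (u, u, u, g) --> u.
  by apply: cvg_comp c0 _; exact: cvg_snd.
have c4 : (fun z : G * G * G * G => z.2) @ (u, u, u, g) --> g.
  exact: cvg_snd.
pose f (z : G * G * G * G) := z.1.1.1^-1 * z.2 * z.1.1.2.
have cf : f @ (u, u, u, g) --> k0.
  apply: cvgMg; last exact: c2.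
  by apply: cvgMg; [apply: cvgVg; exact: c1|exact: c4].
have cf' : (fun z => z.1.2 * f z * z.1.2^-1) @ (u, u, u, g) --> g.
  have gE : u * k0 * u^-1 = g by rewrite /k0 !mulgA mulgV mul1g mulgK.
  suff : (fun z => z.1.2 * f z * z.1.2^-1) @ (u, u, u, g) --> u * k0 * u^-1.
    by rewrite gE.
  apply: cvgMg; last by apply: cvgVg; exact: c3.
  by apply: cvgMg; [exact: c3|exact: cf].
have nf : nbhs (u, u, u, g) (f @^-1` (Q1 `&` Q2)).
  by apply: cf; exact: filterI.
have nf' : nbhs (u, u, u, g) ((fun z => z.1.2 * f z * z.1.2^-1) @^-1` C) :=
  cf' _ Cg.
have [[B T] /= [nB nT] BT] := filterI nf nf'.
have [[B' A3] /= [nB' nA3] B'A] := nB.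
have [[A1 A2] /= [nA1 nA2] AB'] := nB'.
have AT n1 n2 n3 t : A1 n1 -> A2 n2 -> A3 n3 -> T t ->
    (Q1 `&` Q2) (n1^-1 * t * n2) /\ C (n3 * (n1^-1 * t * n2) * n3^-1).
  move=> An1 An2 An3 Tt; apply: (BT (n1, n2, n3, t)); split=> //.
  by apply: (B'A (n1, n2, n3)); split=> //; exact: (AB' (n1, n2)).
exists (A1 `&` A2 `&` A3), T; split=> //.
- by do !apply: filterI.
- move=> n1 n2 n3 t [[? _] _] [[_ ?] _] [_ ?] ?.
  by have [] := AT n1 n2 n3 t.
- exists (Q1 `&` Q2).
    move=> n1 n2 t [[? _] ?] [[_ ?] _] ?.
    by have [] := AT n1 n2 n1 t.
  by move=> k k' [Qk _] [_ Qk']; exact: (Q12 (k, k')).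
Qed.

End Nets.

(** * Stabilizers of limits of cosets *)

Section Veech.
Variable G : topologicalGroupType.
Hypotheses (hG : hausdorff_space G) (lcG : locally_compact [set: G]).
Variable H : closedSubgroup G.

(* If [g] fixes [p] but is not in [L], a set [E] such that [y H] is in [E] for [F]-many
   [y] while [T y] misses [E] for some neighbourhood [T] of [g] and all [y] in [E]
   separates [p] from [g p].  It is a thickened independent piece of a net [D]. *)
Lemma stab_hat_limit (F : set_system G) (p : fell_flow hG lcG)
    (L : closedSubgroup G) : UltraFilter F ->
    (hat hG lcG H) @ F --> p -> (fun y => conjsg y H) @ F --> L ->
  stab_set p `<=` L.
Proof.
move=> FU Fp FL g gp; apply: contrapT => nLg.
have : nbhs g (~` L).
  by apply: open_nbhs_nbhs; split=> //; exact/closed_openC/csg_closed.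
move=> /(compact_nbhs hG lcG)[C [Cg cC CL]].
pose A := [set y : G | conjsg y H `&` C = set0].
have FA : F A.
  apply: (FL [set K : closedSubgroup G | K `&` C = set0]).
  apply: open_nbhs_nbhs; split; first exact: open_chabauty_misses.
  by apply/seteqP; split=> // x [Lx /CL].
have [U [U1 cU _ UV]] := compact_symmetric_nbhs hG lcG (@filterT _ (nbhs (1 : G)) _).
have [D [UD Dsep]] := @separated_net G H U (nbhs_singleton U1) UV.
have [u Uu FND] := ultra_thicken FU cU UD.
have [N [T [nN nT NTC [Q NTQ QU]]]] := conjugate_window u U1 Cg.
(* [D'] keeps the net points near some [y] of [A]; [r] says that some [t] in [T] carries the coset
   of [n2 * d] to that of [n1 * d']. *)
pose D' := [set d | D d /\ exists n h, [/\ N n, csg_set H h & A (n * d * h)]].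
pose r d d' := exists n1 n2 t h,
  [/\ N n1, N n2, T t, csg_set H h & d' = n1^-1 * t * n2 * d * h].
(* If [r d d], then [n1^-1 * t * n2] stabilizes [d H]; its conjugate by [n] lies in [C] and
   stabilizes [n d H], against the choice of [D']. *)
have irr d : D' d -> ~ r d d.
  move=> [_ [n [k [Nn Hk Ank]]]] [n1 [n2 [t [h [Nn1 Nn2 Tt Hh E]]]]].
  pose c := n * (n1^-1 * t * n2) * n^-1.
  suff : set0 c by [].
  rewrite -Ank; split; last exact: NTC.
  exists (k^-1 * h^-1 * k).
    by apply: csg_mul => //; apply: csg_mul; exact: csg_inv.
  rewrite /c; have -> : n1^-1 * t * n2 = d * h^-1 * d^-1.
    by rewrite {1}E !mulgK.
  by rewrite !invgM !mulgA !mulgK.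
(* Two displacements in [Q] differ by an element of [U], so separation of [D] makes [r]
   single-valued; [Qeq'] gives injectivity likewise. *)
have Qeq k k' d d' d'' h h' : Q k -> Q k' -> D d' -> D d'' ->
    csg_set H h -> csg_set H h' ->
    d' = k * d * h -> d'' = k' * d * h' -> d' = d''.
  move=> Qk Qk' Dd' Dd'' Hh Hh' E E'.
  have [Ukk' _] := QU _ _ Qk Qk'.
  apply: (Dsep _ _ (k * k'^-1) (h'^-1 * h)) => //.
    by apply: csg_mul => //; exact: csg_inv.
  by rewrite E E' !mulgA mulgVK mulgK.
have Qeq' k k' d d' d'' h h' : Q k -> Q k' -> D d' -> D d'' ->
    csg_set H h -> csg_set H h' ->
    d = k * d' * h -> d = k' * d'' * h' -> d' = d''.
  move=> Qk Qk' Dd' Dd'' Hh Hh' E E'.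
  have [_ Ukk'] := QU _ _ Qk Qk'.
  apply: (Dsep _ _ (k^-1 * k') (h' * h^-1)) => //.
    by apply: csg_mul => //; exact: csg_inv.
  have -> : d' = k^-1 * d * h^-1 by rewrite E !mulgA mulVg mul1g mulgK.
  by rewrite E' !mulgA.
have [||B1 [B2 [B3 [DB Bind]]]] := independent_cover irr.
- move=> d d' d'' _ [Dd' _] [Dd'' _].
  move=> [n1 [n2 [t [h [Nn1 Nn2 Tt Hh E]]]]] [m1 [m2 [s [k [Nm1 Nm2 Ts Hk E']]]]].
  by apply: (Qeq _ _ d _ _ h k (NTQ n1 n2 t _ _ _) (NTQ m1 m2 s _ _ _)).
- move=> d' d'' d [Dd' _] [Dd'' _] _.
  move=> [n1 [n2 [t [h [Nn1 Nn2 Tt Hh E]]]]] [m1 [m2 [s [k [Nm1 Nm2 Ts Hk E']]]]].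
  by apply: (Qeq' _ _ d _ _ h k (NTQ n1 n2 t _ _ _) (NTQ m1 m2 s _ _ _)).
(* One of the three pieces is [F]-large after thickening; otherwise some [y] of [A] near [D] would
   avoid all three. *)
have [B [BD' Bi FB]] : exists B, [/\ B `<=` D',
    forall x y, B x -> B y -> ~ r x y & F (thicken H N B)].
  apply: contrapT => nB.
  have nF B : B = B1 \/ B = B2 \/ B = B3 -> F (~` thicken H N B).
    move=> /Bind[BD' Bi]; apply: ultra_setC => FB; apply: nB.
    by exists B.
  have nF1 := nF B1 (or_introl erefl).
  have nF2 := nF B2 (or_intror (or_introl erefl)).
  have nF3 := nF B3 (or_intror (or_intror erefl)).
  have [y [[[[n [d [h [Nn Dd Hh yE]]]] Ay] nB1] [nB2 nB3]]] := filter_ex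
    (filterI (filterI (filterI (FND N nN) FA) nF1) (filterI nF2 nF3)).
  have D'd : D' d by split=> //; exists n, h; rewrite -yE.
  by case: (DB _ D'd) => [[]|] Bd; [apply: nB1|apply: nB2|apply: nB3];
    exists n, d, h.
pose E := thicken H N B.
have E1 : p E 1.
  apply: contrapT => nE1.
  have Fm : F [set y | hat hG lcG H y E `&` [set 1] = set0].
    apply: (Fp [set q : closedFamily G (set G) | q E `&` [set 1] = set0]).
    apply: open_nbhs_nbhs; split.
      by apply: open_fell_misses; exact: compact_set1.
    by apply/seteqP; split=> // x [px x1]; apply: nE1; rewrite -x1.
  have [y [Ey y1]] := filter_ex (filterI FB Fm).
  suff : set0 (1 : G) by [].
  rewrite -y1; split=> //; apply: subset_closure.
  by exists 1; [exact: csg_one|rewrite mul1g mulg1].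
have Eg : p E g.
  have gpE : translate g p = p := gp.
  by move: E1; rewrite -{1}gpE /= mul1g.
have Fh : F [set y | hat hG lcG H y E `&` T° !=set0].
  apply: (Fp [set q : closedFamily G (set G) | q E `&` T° !=set0]).
  apply: open_nbhs_nbhs; split; first exact/open_fell_hits/open_interior.
  by exists g.
have [y [[n [b [h [Nn Bb Hh yE]]]] [s [cls Ts]]]] := filter_ex (filterI FB Fh).
have nTs : nbhs s T° by apply: open_nbhs_nbhs; split=> //; exact: open_interior.
have [t [[k Hk [m [b' [l [Nm Bb' Hl tyE]]]]] /interior_subset Tt]] := cls _ nTs.
apply: (Bi b b') => //; exists m, n, t, (h * k * l^-1); split=> //.
  by apply: csg_mul; [exact: csg_mul|exact: csg_inv].
have -> : b' = m^-1 * (m * b' * l) * l^-1 by rewrite !mulgA mulVg mul1g mulgK.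
by rewrite -tyE yE !mulgA.
Qed.

Lemma stabilizer_hat_closure (A : set (closedSubgroup G)) (p : fell_flow hG lcG) :
    closed A -> conj_invariant A -> A H -> closure (range (hat hG lcG H)) p ->
  A (stabilizer p).
Proof.
move=> clA Ainv AH clp.
pose F0 := filter_from (nbhs p) (fun B => hat hG lcG H @^-1` B).
have PF0 : ProperFilter F0.
  apply: filter_from_proper => [|B /clp[_ [[x _ <-] Bx]]]; last by exists x.
  apply: filter_from_filter; first by exists setT; exact: filterT.
  by move=> B C pB pC; exists (B `&` C) => //; exact: filterI.
have [F [FU F0F]] := ultraFilterLemma PF0.
have Fp : (hat hG lcG H) @ F --> p by move=> B pB; apply: F0F; exists B.
have [L FL] := @ultra_compact_cvg _ _ F (fun y => conjsg y H)
  (@compact_closedSubgroup G) FU.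
have AL : A L.
  apply: clA => B LB; have FB : F ((fun y => conjsg y H) @^-1` B) := FL _ LB.
  by have [y By] := filter_ex FB; exists (conjsg y H); split=> //; exact: Ainv.
suff -> : stabilizer p = L by [].
apply: closedSubgroup_eq; apply/seteqP; split; first exact: stab_hat_limit Fp FL.
apply: (@stab_limit _ _ _ F _ (hat hG lcG H) p (fun y => conjsg y H)) => //.
  by move=> y; exact: hat_stab.
move=> V oV LV; apply: (FL [set K : closedSubgroup G | K `&` V !=set0]).
by apply: open_nbhs_nbhs; split=> //; exact: open_chabauty_hits.
Qed.

End Veech.

(** * Convergent sequences in the Fell flow *)

Lemma separate_translates (G : topologicalGroupType) (X : compactGSpace G)
    (V : set G) (x p : X) :
    compact V -> (forall v, V v -> x <> cgs_act v p) ->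
  exists O P, [/\ nbhs x O, nbhs p P &
    forall o q v, O o -> P q -> V v -> o <> cgs_act v q].
Proof.
move=> /compact_near_coveringP cV Vxp.
have FF : Filter (nbhs ((x, p) : X * X)) by exact: nbhs_filter.
have [|[ O P] /= [nO nP] OP] := cV _ _ (fun z v => z.1 <> cgs_act v z.2) FF.
  move=> v Vv; have /eqP xvp := Vxp v Vv.
  have := @cgs_hausdorff _ X; rewrite open_hausdorff => /(_ _ _ xvp).
  move=> [[A B] /=]; rewrite !inE => -[Ax Bvp] [oA oB AB].
  have : nbhs (cgs_act v p) B by exact: open_nbhs_nbhs.
  move=> /(@cgs_continuous _ X (v, p))[[C D] /= [nC nD] CDB].
  exists (C, A `*` D) => /=.
    split=> //; exists (A, D) => //; split=> //.
    exact: open_nbhs_nbhs.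
  move=> [w [y q]] [/= Cw [Ay Dq]] /= yE.
  suff : set0 y by [].
  by rewrite -AB; split=> //; rewrite yE; exact: (CDB (w, q)).
by exists O, P; split=> // o q v Oo Pq Vv; exact: (OP (o, q)).
Qed.

Section Sequences.
Variable G : topologicalGroupType.
Hypotheses (hG : hausdorff_space G) (lcG : locally_compact [set: G]).
Variable H : closedSubgroup G.
Local Notation hat := (hat hG lcG H).

(** Each [x n] and [p] have neighbourhoods that no element of [V] links. Later terms are picked
    inside the neighbourhoods of [p] attached to all earlier ones, and their windows are shrunk
    accordingly. *)
Lemma separated_subsequence (X : compactGSpace G) (V : set G) (x : nat -> X)
    (p : X) : compact V -> x @ \oo --> p ->
    (forall n v, V v -> x n <> cgs_act v p) ->
  exists (s : nat -> nat) (O : nat -> set X), [/\ forall k, (k <= s k)%N,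
    forall k, nbhs (x (s k)) (O k) &
    forall j k o o' v, (j < k)%N -> O j o -> O k o' -> V v -> o <> cgs_act v o'].
Proof.
move=> cV xp Vxp.
have /choice[OP OPsep] : forall n, exists OP : set X * set X,
    [/\ nbhs (x n) OP.1, nbhs p OP.2 &
      forall o q v, OP.1 o -> OP.2 q -> V v -> o <> cgs_act v q].
  move=> n; have [ O [P ?]] := separate_translates cV (Vxp n).
  by exists (O, P).
pose Q n := [set z | forall j, (j <= n)%N -> (OP j).2 z].
have nQ n : nbhs p (Q n).
  elim: n => [|n IHn].
    have [_ nP _] := OPsep 0%N; apply: filterS nP => z Pz j.
    by rewrite leqn0 => /eqP ->.
  have [_ nP _] := OPsep n.+1; apply: filterS2 nP IHn => z Pz Qz j.
  by rewrite leq_eqVlt => /orP[/eqP ->//|]; exact: Qz.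
have /choice[N NQ] : forall n, exists m, (n < m)%N /\ nbhs (x m) (Q n).
  move=> n; have /xp[m _ mQ] := nbhs_interior (nQ n).
  exists (maxn m n.+1); split; first exact: leq_maxr.
  by apply: mQ; exact: leq_maxl.
pose s k := iter k N 0%N.
have sS k : (s k < s k.+1)%N by have [] := NQ (s k).
have s_mono j k : (j <= k)%N -> (s j <= s k)%N.
  by apply: (homo_leq leqnn leq_trans) => i; exact/ltnW.
exists s, (fun k => (OP (s k)).1 `&`
  [set z | forall j, (j < k)%N -> (OP (s j)).2 z]); split.
- by elim=> // k IHk; exact: leq_ltn_trans IHk (sS k).
- move=> k; apply: filterI; first by have [] := OPsep (s k).
  case: k => [|k]; first exact: filterE.
  have [_] := NQ (s k); apply: filterS => z Qz j jk; apply: Qz.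
  by apply: s_mono; rewrite -ltnS.
- move=> j k o o' v jk [ Oo _] [_ /(_ j jk) Po'] Vv.
  by have [_ _] := OPsep (s j); apply.
Qed.

(* Convergent sequences of the Fell flow converge along the orbit of the limit:
   otherwise the indicator of every other term of a separated subsequence would
   have no limit. *)
Lemma hat_sequence (V : set G) (x : nat -> fell_flow hG lcG)
    (p : fell_flow hG lcG) :
    nbhs 1 V -> compact V -> (forall v, V v -> V v^-1) ->
    (forall n, closure (range hat) (x n)) -> x @ \oo --> p ->
  exists n v, V v /\ x n = cgs_act v p.
Proof.
move=> V1 cV VV clx xp; apply: contrapT => nxp.
have [|s [ O [sk nO Osep]]] := separated_subsequence cV xp.
  by move=> n v Vv xnE; apply: nxp; exists n, v.
pose E := [set y | exists2 k, ~~ odd k & O k (hat y)].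
have xs B b : open B -> B p -> exists2 k, odd k = b &
    exists y, B (hat y) /\ O k (hat y).
  move=> oB Bp; have /xp[m _ mB] : nbhs p B by exact: open_nbhs_nbhs.
  (* The index [b + 2m] has parity [b] and is at least [m], so [s] sends it into the tail of [x]
     lying in [B]. *)
  exists (b + m.*2)%N; first by rewrite oddD odd_double addbF oddb.
  have nB : nbhs (x (s (b + m.*2)%N)) B.
    apply: open_nbhs_nbhs; split=> //; apply: mB => /=.
    apply: leq_trans (sk _); rewrite -addnn addnA; exact: leq_addl.
  by have [_ [[y _ <-] [? ?]]] := clx _ _ (filterI nB (nO _)); exists y.
have E1 : p E 1.
  apply: contrapT => nE1.
  have [||k kE [y [y1 Oy]]] := xs [set q : closedFamily G (set G) |
    q E `&` [set 1] = set0] false.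
  - by apply: open_fell_misses; exact: compact_set1.
  - by apply/seteqP; split=> // z [pz z1]; apply: nE1; rewrite -z1.
  suff : set0 (1 : G) by [].
  rewrite -y1; split=> //; apply: subset_closure.
  exists 1; first exact: csg_one.
  by rewrite mul1g mulg1; exists k => //; rewrite kE.
(* The even windows put 1 in [p E], so near [p] some [hat y] in an odd window [k] is moved by some
   [w] in [V] into an even window [j]; separation forbids this in either order of [j] and [k]. *)
have [||k kO [y [[v [clv Vv]] Oy]]] := xs [set q : closedFamily G (set G) |
    q E `&` V° !=set0] true.
- exact/open_fell_hits/open_interior.
- by exists 1.
have nV : nbhs v V° by apply: open_nbhs_nbhs; split=> //; exact: open_interior.
have [w [[h Hh [j jE Oj]] /interior_subset Vw]] := clv _ nV.
move: Oj; rewrite hat_coset // -hat_act => Oj.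
have [jk|kj|jk] := ltngtP j k.
- exact: (Osep j k _ _ w jk Oj Oy).
- apply: (Osep k j _ _ w^-1 kj Oy Oj (VV _ Vw)).
  by rewrite -cgs_actM mulVg cgs_act1.
- by move: jE; rewrite jk kO.
Qed.

(** If [V p] is not a neighbourhood of [p], then [p] is the image of some [m] in the closure of the
    preimage [S] of its complement. Metrizability gives a sequence of [S] tending to [m], and
    [hat_sequence] puts a term of its image back in [V p]. *)
Lemma orbit_nbhs (R : realType) (M : topologicalType) (B : set (fell_flow hG lcG))
    (clB : closed B) (invB : forall g x, B x -> B (cgs_act g x))
    (f : M -> subflow clB invB) (V : set G) :
    B `<=` closure (range hat) -> metrizable R M -> compact [set: M] ->
    continuous f -> range f = [set: subflow clB invB] ->
    nbhs 1 V -> compact V -> (forall v, V v -> V v^-1) ->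
  forall p : subflow clB invB, nbhs p [set cgs_act v p | v in V].
Proof.
move=> Bhat [d [d0 dC dtri dnbhs]] cM cf fsurj V1 cV VV p.
apply: contrapT => nVp.
set S := f @^-1` (~` [set cgs_act v p | v in V]).
have [m clm fm] : (f @` closure S) p.
  have : closed (f @` closure S).
    apply: compact_closed; first exact: cgs_hausdorff.
    apply: continuous_compact; first exact: continuous_subspaceT.
    by apply: subclosed_compact cM _ => //; exact: closed_closure.
  apply => A nA; apply: contrapT => nSA; apply: nVp; apply: filterS nA => q Aq.
  apply: contrapT => nVq; apply: nSA.
  have [a _ aq] : range f q by rewrite fsurj.
  exists q; split=> //; exists a => //; apply: subset_closure.
  by rewrite /S /= aq.
have /choice[z zP] : forall n : nat, exists z, S z /\ (d m z < n.+1%:R^-1)%R.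
  move=> n; apply: clm; rewrite dnbhs.
  by exists (n.+1%:R^-1)%R => //=; rewrite invr_gt0.
have zm : z @ \oo --> m.
  move=> A; rewrite dnbhs => -[e e0 eA].
  have := near_infty_natSinv_lt (PosNum e0).
  apply: filterS => n /= ne; apply: eA; have [_ zn] := zP n.
  exact: lt_trans zn ne.
have [||n [v [Vv xE]]] := @hat_sequence V (fun n => \val (f (z n))) (\val p) V1 cV VV.
- by move=> n; apply: Bhat; exact/set_mem/valP.
- rewrite -fm; apply: (@cvg_comp _ _ _ z (fun m => \val (f m)) _ _ _ zm).
  apply: (@cvg_comp _ _ _ f (\val : B -> fell_flow hG lcG) _ _ _ (cf m)).
  exact: val_continuous.
- have [Sz _] := zP n; apply: Sz; exists v => //.
  by apply: val_inj; rewrite xE.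
Qed.

End Sequences.

(** * Open orbits and cocompact stabilizers *)

Section Transitive.
Variable G : topologicalGroupType.

(** Orbits are open and dense, so there is only one; finitely many sets [V g p] cover it, so a
    compact [K] meets every coset of the stabilizer. *)
Lemma cocompact_stabilizer (X : compactGSpace G) (V : set G) (p : X) :
    hausdorff_space G -> minimal_flow X -> compact V -> nbhs 1 V ->
    (forall x : X, nbhs x [set cgs_act v x | v in V]) ->
  cocompact (stabilizer p).
Proof.
move=> hG [_ Xmin] cV V1 Vx.
have orb x : exists g, x = cgs_act g p.
  have oGp : open (range (fun g => cgs_act g p)).
    rewrite openE => _ [g _ <-]; apply: filterS (Vx (cgs_act g p)).
    by move=> _ [v Vv <-]; exists (v * g) => //; rewrite cgs_actM.
  have [|y [[h _ yh] [g _ yg]]] := Xmin x _ _ oGp.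
    by exists p, 1 => //; rewrite cgs_act1.
  exists (g^-1 * h); apply: (@act_inj _ _ g).
  by rewrite -cgs_actM mulgA mulgV mul1g yg yh.
(* Compact subsets of [G] ordered by inclusion: the near-covering property yields one compact [K]
   with [K p = X]. *)
pose FF := filter_from (@compact G) (fun K => [set L | compact L /\ K `<=` L]).
have PFF : ProperFilter FF.
  apply: filter_from_proper; last by move=> K cK; exists K; split.
  apply: filter_from_filter; first by exists set0; exact: compact0.
  move=> K L cK cL; exists (K `|` L); first exact: compactU.
  by move=> D [cD]; rewrite subUset => -[].
have /compact_near_coveringP cX := @cgs_compact _ X.
have [K cK /(_ K) KX] : FF [set K | [set: X] `<=` [set cgs_act k p | k in K]].
  apply: (cX _ FF (fun K x => [set cgs_act k p | k in K] x) _) => x _.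
  have [g xg] := orb x.
  exists ([set cgs_act v x | v in V],
      [set L | compact L /\ [set v * g | v in V] `<=` L]) => /=.
    split=> //; exists [set v * g | v in V] => //.
    apply: continuous_compact cV; apply: continuous_subspaceT => v.
    by apply: cvgMg; [exact: cvg_id|exact: cvg_cst].
  move=> [_ L] [/= [v Vv <-] [_ VL]].
  by exists (v * g); [apply: VL; exists v|rewrite cgs_actM xg].
rewrite /cocompact.
pose pr : G -> coset_space (stabilizer p) :=
  \pi_{eq_quot same_coset_equiv (stabilizer p)}%qT.
suff -> : [set: coset_space (stabilizer p)] = pr @` K.
  apply: continuous_compact cK; apply: continuous_subspaceT.
  exact: pi_continuous.
apply/seteqP; split=> // q _.
have [k Kk kq] := KX (conj cK (@subset_refl _ K)) (cgs_act (repr q) p) I.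
exists k => //; rewrite -[q]reprK; apply/eqmodP/asboolP.
by rewrite /= /stab_set /= cgs_actM -kq -cgs_actM mulVg cgs_act1.
Qed.

End Transitive.

(** * Metrizability of transitive flows *)

Section Metrization.
Variables (R : realType) (T : topologicalType).
Hypotheses (cT : compact [set: T]) (hT : hausdorff_space T).
Local Open Scope ring_scope.

Lemma separating_functions : @second_countable T ->
  exists F : nat -> T -> R, [/\ forall n, continuous (F n),
    forall n x, 0 <= F n x <= 1 &
    forall x A, nbhs x A -> exists2 n, F n x = 0 & forall y, ~ A y -> F n y = 1].
Proof.
move=> [B /countable_injP[f finj] [Bo Bb]].
pose b n := [set x | exists U, [/\ B U, f U = n & U x]].
have bf U : B U -> b (f U) = U.
  move=> BU; apply/seteqP; split=> [x [W [BW fWU Wx]]|x Ux]; last by exists U.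
  by rewrite -(finj W U) // inE.
(* [n] codes a pair of basic sets, the useful ones having the closure of the first inside the
   second; other codes still give continuous functions with values in [[0, 1]]. *)
pose F n : T -> R := if unpickle n is Some (i, j)
  then Urysohn (closure (b i)) (~` b j) else fun=> 0.
exists F; split.
- move=> n; rewrite /F; case: (unpickle n) => [[i j]|].
    exact: Urysohn_continuous.
  by move=> x; exact: cvg_cst.
- move=> n x; rewrite /F; case: (unpickle n) => [[i j]|]; last by rewrite lexx ler01.
  have /(_ (Urysohn (closure (b i)) (~` b j) x)) :=
    @Urysohn_range T R (closure (b i)) (~` b j).
  by rewrite /= in_itv /=; apply; exists x.
- move=> x A /Bb[U [BU Ux] UA].
  have nU : nbhs x U by apply: open_nbhs_nbhs; split=> //; exact: Bo.
  have [D nD DU] := compact_regular hT cT filterT nU.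
  have [W [BW Wx] WD] := Bb _ _ nD.
  have sepWU : uniform_separator (closure W) (~` U).
    apply: ((@normal_separatorP R T).1 (compact_normal hT cT)).
    - exact: closed_closure.
    - exact/open_closedC/Bo.
    - apply/disjoints_subset; rewrite setCK.
      by apply: subset_trans DU; exact: closureS.
  exists (pickle (f W, f U)).
    rewrite /F pickleK !bf //.
    apply: (@Urysohn_sub0 T R (closure W) (~` U)) => //.
    by exists x => //; exact: subset_closure.
  move=> y nAy; rewrite /F pickleK !bf //.
  apply: (@Urysohn_sub1 T R (closure W) (~` U)) => //.
  by exists y => // /UA.
Qed.

(** The metric is the supremum of the [|F n x - F n y| / (n + 1)]; the decaying weights let each
    ball depend on finitely many [F n]. *)
Lemma compact_metrizable : @second_countable T -> metrizable R T.
Proof.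
move=> /separating_functions[F [cF F01 Fsep]].
pose a n x y := n.+1%:R^-1 * `|F n x - F n y|.
pose S x y := [set a n x y | n in [set: nat]].
have F1 n x y : `|F n x - F n y| <= 1.
  have /andP[x0 x1] := F01 n x; have /andP[y0 y1] := F01 n y.
  by rewrite ler_norml; apply/andP; split; lra.
have inv0 n : 0 < n.+1%:R^-1 :> R by rewrite invr_gt0.
have a_le n x y : a n x y <= n.+1%:R^-1.
  by rewrite /a ler_piMr // ltW.
have S_ub x y : has_ubound (S x y).
  exists 1 => _ [n _ <-]; apply: le_trans (a_le n x y) _.
  by rewrite invf_le1 // ler1n.
have S0 x y : S x y !=set0 by exists (a 0%N x y), 0%N.
have le_d n x y : a n x y <= sup (S x y) by apply: ub_le_sup => //; exists n.
exists (fun x y => sup (S x y)); split.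
- move=> x y; split=> [dxy|->].
    apply: contrapT => xy.
    have nx : nbhs x (~` [set y]).
      apply: open_nbhs_nbhs; split=> //; apply: closed_openC.
      exact: accessible_closed_set1 (hausdorff_accessible hT) _.
    have [n Fx Fy] := Fsep _ _ nx.
    have := le_d n x y; rewrite dxy /a Fx Fy; last by apply.
    by rewrite sub0r normrN normr1 mulr1 leNgt inv0.
  apply/eqP; rewrite eq_le; apply/andP; split.
    by apply: ge_sup => // _ [n _ <-]; rewrite /a subrr normr0 mulr0.
  by apply: le_trans (le_d 0%N y y); rewrite /a subrr normr0 mulr0.
- move=> x y; congr sup; apply/seteqP.
  by split=> _ [n _ <-]; exists n => //; rewrite /a distrC.
- move=> x y z; apply: ge_sup => // _ [n _ <-].
  apply: le_trans (lerD (le_d n x y) (le_d n y z)).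
  by rewrite /a -mulrDr; apply: ler_wpM2l; [exact: ltW|exact: ler_distD].
- move=> x; apply/seteqP; split=> A.
    move=> /Fsep[n Fx FA]; exists n.+1%:R^-1 => //= y /= dxy.
    apply: contrapT => /FA Fy; have := le_lt_trans (le_d n x y) dxy.
    by rewrite /a Fx Fy sub0r normrN normr1 mulr1 ltxx.
  move=> [e /= e0 eA]; have e2 : 0 < e / 2 by rewrite divr_gt0.
  (* Terms from [N] on are below [e / 2] by their weight, the others by continuity; [e / 2] is used
     because a supremum of strict bounds is only weakly bounded. *)
  have [N _ NP] := near_infty_natSinv_lt (PosNum e2).
  have : \forall y \near x, forall i : 'I_N, `|F i x - F i y| < e / 2.
    apply: filter_forall => i.
    by have /cvgrPdist_lt /(_ _ e2) := cF i x.
  apply: filterS => y Fy; apply: eA => /=.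
  apply: (@le_lt_trans _ _ (e / 2)); last by lra.
  apply: ge_sup => // _ [n _ <-].
  have [nN|Nn] := ltnP n N.
    apply: le_trans (ltW (Fy (Ordinal nN))); rewrite /a /= ler_piMl //.
    by rewrite invf_le1 // ler1n.
  by apply: le_trans (a_le n x y) (ltW _); exact: NP.
Qed.

End Metrization.

Section CocompactSubgroup.
Variables (G : topologicalGroupType) (X : compactGSpace G).
Variables (H : closedSubgroup G) (p : X).
Hypotheses (Xmin : minimal_flow X) (cH : cocompact H).
Hypothesis Hp : (H : set G) `<=` stab_set p.

Let pr : G -> coset_space H := \pi_{eq_quot same_coset_equiv H}%qT.
Let orb (q : coset_space H) : X := cgs_act (repr q) p.

Lemma orbit_coset (g : G) : orb (pr g) = cgs_act g p.
Proof.
have /eqmodP/asboolP/Hp : (pr g = pr (repr (pr g)) :> {eq_quot same_coset_equiv H}%qT).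
  by rewrite /pr reprK.
rewrite /stab_set /= cgs_actM => /(congr1 (cgs_act g)).
by rewrite -cgs_actM mulgV cgs_act1.
Qed.

Lemma act_point_continuous : continuous (fun g : G => cgs_act g p).
Proof.
move=> g; apply: (@cvg_act _ _ _ (nbhs g) _ id (fun=> p)).
  exact: cvg_id.
exact: cvg_cst.
Qed.

Lemma orbit_coset_continuous : continuous orb.
Proof.
apply/quotient_continuous.
rewrite (_ : _ \o _ = fun g : G => cgs_act g p); first exact: act_point_continuous.
by apply/funext => g; exact: orbit_coset.
Qed.

Lemma closed_orbit_image (C : set (coset_space H)) :
  closed C -> closed (orb @` C).
Proof.
move=> clC; apply: compact_closed; first exact: cgs_hausdorff.
apply: continuous_compact; first exact/continuous_subspaceT/orbit_coset_continuous.
exact: subclosed_compact clC cH _.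
Qed.

(** The orbit of [p] is dense and, as the image of the compact [G/H], closed. *)
Lemma orbit_transitive (x : X) : exists g : G, x = cgs_act g p.
Proof.
have [_ /(_ p) dp] := Xmin.
have clT := closed_orbit_image closedT.
apply: contrapT => nx.
have [||y [nTy [g _ gy]]] := dp (~` (orb @` setT)).
- by exists x => -[q _ qx]; apply: nx; exists (repr q); rewrite -qx.
- exact: closed_openC.
by apply: nTy; exists (pr g) => //; rewrite orbit_coset.
Qed.

(** The orbit map from [G/H] is closed and onto, so it suffices that the preimage of [U p] be open,
    which is checked in [G]. *)
Lemma orbit_open (U : set G) :
  open U -> open [set cgs_act u p | u in U].
Proof.
move=> oU; set UP := [set cgs_act u p | u in U].
have oV : open (orb @^-1` UP).
  have : open ((fun g : G => cgs_act g p) @^-1` UP).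
    rewrite openE => g [u Uu ug].
    (* As [u p = g p], the element [u^-1 * g] fixes [p], and right division by it carries [g] to [u]
       in [U]. *)
    have c : (fun h => h * (u^-1 * g)^-1) @ g --> g * (u^-1 * g)^-1.
      by apply: cvgMg; [exact: cvg_id|exact: cvg_cst].
    have : nbhs g ((fun h => h * (u^-1 * g)^-1) @^-1` U).
      apply: c; apply: open_nbhs_nbhs; split=> //.
      by rewrite invgM invgK mulgA mulgV mul1g.
    apply: filterS => h Uh; exists (h * (u^-1 * g)^-1) => //.
    by rewrite invgM invgK !cgs_actM ug -!cgs_actM mulgVK.
  rewrite (_ : (fun g : G => cgs_act g p) @^-1` UP = pr @^-1` (orb @^-1` UP)) //.
  by apply/seteqP; split=> g /=; rewrite orbit_coset.
have -> : UP = ~` (orb @` (~` (orb @^-1` UP))).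
  apply/seteqP; split=> [x UPx [q nq qx]|x nx]; first by apply: nq; rewrite /= qx.
  have [g xg] := orbit_transitive x.
  apply: contrapT => nUP; apply: nx; exists (pr g); last by rewrite orbit_coset.
  by rewrite /= orbit_coset -xg.
by apply/closed_openC/closed_orbit_image/open_closedC.
Qed.

Lemma second_countable_flow : @second_countable G -> @second_countable X.
Proof.
move=> [B cB [Bo Bb]]; exists [set [set cgs_act u p | u in U] | U in B].
  exact: sub_countable (card_image_le _ _) cB.
split=> [_ [U BU <-]|x A nA]; first exact/orbit_open/Bo.
have [g xg] := orbit_transitive x.
have /Bb[U [BU Ug] UA] : nbhs g ((fun g : G => cgs_act g p) @^-1` A).
  by apply: act_point_continuous; rewrite -xg.
exists [set cgs_act u p | u in U].
  by split; [exists U|exists g].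
by move=> _ [u /UA ? <-].
Qed.

End CocompactSubgroup.

(** * The theorem *)

Lemma subflow_minimal (G : topologicalGroupType) (X : compactGSpace G) (B : set X)
    (clB : closed B) (invB : forall g x, B x -> B (cgs_act g x)) :
    B !=set0 ->
    (forall B', B' `<=` B -> B' !=set0 -> closed B' ->
      (forall g x, B' x -> B' (cgs_act g x)) -> B' = B) ->
  minimal_flow (subflow clB invB).
Proof.
move=> [b Bb] Bmin; split; first by exists (exist _ b (mem_set Bb)).
move=> x A [y Ay] [W oW WA].
pose C := closure (range (fun g => cgs_act g (\val x))).
have CB : C = B.
  apply: Bmin; last 2 first.
  - exact: closed_closure.
  - move=> g z Cz D nD.
    have f : (fun w : X => cgs_act g w) @ z --> cgs_act g z.
      by apply: (@cvg_act _ _ _ (nbhs z) _ (fun=> g) id); [exact: cvg_cst|exact: cvg_id].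
    have [_ [[h _ <-] Dh]] := Cz _ (f _ nD).
    by exists (cgs_act g (cgs_act h (\val x))); split=> //;
      exists (g * h); rewrite ?cgs_actM.
  - move=> z Cz; apply: (clB z) => D /Cz[_ [[g _ <-] Dg]].
    by exists (cgs_act g (\val x)); split=> //; exact: (invB g _ (set_mem (valP x))).
  - by exists (cgs_act 1 (\val x)); apply: subset_closure; exists 1.
have Cy : C (\val y) by rewrite CB; exact: set_mem (valP y).
have [|_ [[g _ <-] Wg]] := Cy W.
  by apply: open_nbhs_nbhs; split=> //; move: Ay; rewrite -WA.
by exists (@cgs_act G (subflow clB invB) g x); split; [rewrite -WA|exists g].
Qed.

Theorem theorem3p11 (R : realType) (G : topologicalGroupType)
    (G_hausdorff : hausdorff_space G)
    (G_locally_compact : locally_compact [set: G]%classic)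
    (G_second_countable : @second_countable G)
    (calH : set (closedSubgroup G)) (calH_URS : is_URS calH)
    (M : compactGSpace G) (M_universal : is_universal_minimal_flow calH M) :
  metrizable R M <-> exists2 H, calH H & cocompact H.
Proof.
have [M_minimal M_sub M_onto] := M_universal.
split=> [M_metrizable|[H calH_H cH]]; last first.
  have [K /(stabilizer_URSP (proj1 M_minimal)).2 /closure_stabilizer_le[m Km] HK] :=
    M_sub H calH_H.
  apply: compact_metrizable; [exact: cgs_compact|exact: cgs_hausdorff|].
  by apply: (@second_countable_flow _ _ H m) => //; exact: subset_trans Km.
have [[H calH_H] calH_closed calH_inv _] := calH_URS.
pose hats := range (hat G_hausdorff G_locally_compact H).
have [|||B [B_hats B0 B_closed B_inv B_min]] :=
  @minimal_closed_invariant (fell_flow G_hausdorff G_locally_compact) G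
    (@cgs_act G _) (closure hats) (@cgs_compact G _).
- exact: closed_closure.
- by exists (hat G_hausdorff G_locally_compact H 1); apply: subset_closure; exists 1.
- by move=> g x; exact: closure_hat_act.
pose X := subflow B_closed B_inv.
have X_minimal : minimal_flow X by exact: subflow_minimal.
have X_stab (x : X) : calH (stabilizer x).
  suff -> : stabilizer x = stabilizer (\val x : fell_flow _ _).
    apply: stabilizer_hat_closure calH_closed calH_inv calH_H _.
    exact: B_hats (set_mem (valP x)).
  apply: closedSubgroup_eq; apply/seteqP; split=> g /=.
    by move=> /(congr1 \val).
  by move=> gx; exact: val_inj.
have X_sub : subordinate calH X.
  rewrite /subordinate (@stabilizer_URS_eq _ X calH) //; first by move=> K; exists K.
    exact: (proj1 X_minimal).
  by move=> _ [x _ <-].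
have [f [f_cont f_onto _]] := M_onto X X_minimal X_sub.
have [V [V1 cV _ VV]] :=
  compact_symmetric_nbhs G_hausdorff G_locally_compact (@filterT _ (nbhs (1 : G)) _).
(* Every stabilizer of [X] is in [calH], so any point [p] serves. *)
have [[p _] _] := X_minimal.
exists (stabilizer p) => //; apply: (cocompact_stabilizer G_hausdorff X_minimal cV V1).
exact: orbit_nbhs B_hats M_metrizable (@cgs_compact _ M) f_cont f_onto V1 cV VV.
Qed.
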